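(* For every $n\ge1$, the map $f\colon\mathcal{T}_n(P,e)\to\mathcal{M}'_{n-1}(Z)$ is a bijection in each of the following four cases: (i) $(P,e)=(2134,111)$, $Z=\{\mathtt{U}\mathtt{U},\mathtt{U}\mathtt{F}_R\}$; (ii) $(P,e)=(3214,111)$, $Z=\{\mathtt{D}\mathtt{U},\mathtt{D}\mathtt{F}_L\}$; (iii) $(P,e)=(1324,111)$, $Z=\{\mathtt{U}\mathtt{U},\mathtt{F}_R\mathtt{U}\}$; (iv) $(P,e)=(1243,111)$, $Z=\{\mathtt{U},\mathtt{F}_R\}\times\{\mathtt{U},\mathtt{F}_R\}\times\{\mathtt{U},\mathtt{F}_L\}$ (all 8 three-letter words $xyz$ with $x,y\in\{\mathtt U,\mathtt F_R\}$, $z\in\{\mathtt U,\mathtt F_L\}$). Moreover, $(2134,111)=(2134,\text{-}1\text{-})$, $(3214,111)=(3214,1\text{-}\text{-})$, $(1324,111)=(1324,1\text{-}\text{-})$ and $(1243,111)=(1243,1\text{-}\text{-})$ in the sense that the set of avoiding trees does not change when the entries marked ''-'' are replaced by arbitrary values in $\{0,1\}$. Furthermore, for each $n\ge1$ these four sets of Motzkin paths have the same cardinality, and these cardinalities form the sequence OEIS A025242, whose terms for $n=1,2,3,\dots$ are $1,2,5,13,35,97,275,794,2327,6905,\dots$.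
   Context: $\mathcal{T}_n$ is the set of binary trees on $n$ vertices labeled $1,\dots,n$ by the search tree property; $r(T)$ root, $L(T),R(T)$ the left and right subtrees of the root, $c_L,c_R,p$ left child, right child, parent. A tree pattern is $(P,e)$, $P\in\mathcal{T}_k$, $e\colon[k]\setminus\{r(P)\}\to\{0,1\}$; $T$ contains $(P,e)$ if there is an injection $f\colon[k]\to[n]$ such that for each non-root $i$ of $P$: if $e(i)=1$, $f(i)$ is the left (resp. right) child of $f(p(i))$ when $i$ is the left (resp. right) child of $p(i)$; if $e(i)=0$, $f(i)$ lies in the left (resp. right) subtree of $f(p(i))$. $\mathcal{T}_n(P,e)$ is the set of avoiders. Compact notation: $(\tau_1\cdots\tau_k,\,x_2\cdots x_k)$ denotes the pattern $(P,e)$ whose preorder sequence (root, then recursively left subtree, then right subtree) is $\tau_1,\dots,\tau_k$ and with $e(\tau_j)=x_j$. Motzkin paths with 2-colored flat steps: words over $\{\mathtt U,\mathtt D,\mathtt F_L,\mathtt F_R\}$ where $\mathtt U=(1,1)$, $\mathtt D=(1,-1)$, $\mathtt F_L,\mathtt F_R=(1,0)$, starting at $(0,0)$, ending on the $x$-axis, never going below it; $\mathcal{M}'_m$ is the set of such paths with $m$ steps, and $\mathcal{M}'_m(Z)$ those containing no word of $Z$ as a consecutive substring. The map $f$ on nonempty binary trees: if $r(T)$ has no children, $f(T)$ is the empty path; if it has only a left child, $f(T)=\mathtt F_L\,f(L(T))$; if only a right child, $f(T)=\mathtt F_R\,f(R(T))$; if two children, $f(T)=\mathtt U\,f(R(T))\,\mathtt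 D\,f(L(T))$. *)

(* Defs.v *)
From HB Require Import structures.
From mathcomp Require Import all_boot.

Set Implicit Arguments.
Unset Strict Implicit.
Unset Printing Implicit Defensive.

(* Unlabeled binary trees; the labels 1..n are forced by the search tree
   property (in-order labelling), see [label] below. *)
Inductive tree := Leaf | Node of tree & tree.

Fixpoint bt_size (t : tree) : nat :=
  match t with Leaf => 0 | Node l r => (bt_size l + bt_size r).+1 end.

(* A vertex of a tree is identified by its address: the sequence of
   directions (false = left, true = right) from the root. *)
Fixpoint addrs (t : tree) : seq (seq bool) :=
  match t with
  | Leaf => [::]
  | Node l r => [::] :: map (cons false) (addrs l) ++ map (cons true) (addrs r)
  end.

Fixpoint label (t : tree) (a : seq bool) : nat :=
  match t, a with
  | Leaf, _ => 0
  | Node l _, [::] => (bt_size l).+1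
  | Node l _, false :: a' => label l a'
  | Node l r, true :: a' => (bt_size l).+1 + label r a'
  end.

(* The binary search tree with preorder sequence [s] ([fuel] >= size s). *)
Fixpoint bst_of_preorder (fuel : nat) (s : seq nat) : tree :=
  match fuel, s with
  | 0, _ => Leaf
  | _, [::] => Leaf
  | k.+1, x :: s' =>
      Node (bst_of_preorder k [seq y <- s' | y < x])
           (bst_of_preorder k [seq y <- s' | x < y])
  end.

(* A tree pattern (P, e): e is a map from labels of P to bool
   (its value at the root label is irrelevant). *)
Record pattern := Pattern { pat_tree : tree; pat_e : nat -> bool }.

(* Compact notation (tau_1 ... tau_k, x_2 ... x_k):
   P has preorder sequence tau, and e(tau_j) = x_j for j >= 2. *)
Definition pat (tau : seq nat) (xs : seq bool) : pattern :=
  Pattern (bst_of_preorder (size tau) tau)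
          (fun i => nth false xs (index i tau).-1).

(* T contains (P, e): an injection f from the vertices of P to those of T
   such that for every non-root vertex [rcons p b] of P (child of p in
   direction b): if e = 1, f(rcons p b) is the b-child of f(p); if e = 0,
   f(rcons p b) lies in the b-subtree of f(p). *)
Definition contains (T : tree) (Pe : pattern) : Prop :=
  let P := pat_tree Pe in
  exists f : seq bool -> seq bool,
    [/\ (forall a, a \in addrs P -> f a \in addrs T),
        (forall a a', a \in addrs P -> a' \in addrs P -> f a = f a' -> a = a') &
        (forall p b, rcons p b \in addrs P ->
           if pat_e Pe (label P (rcons p b))
           then f (rcons p b) = rcons (f p) b
           else prefix (rcons (f p) b) (f (rcons p b)))].

Definition avoider (n : nat) (Pe : pattern) (T : tree) : Prop :=
  bt_size T = n /\ ~ contains T Pe.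

Inductive step := U | D | FL | FR.

Definition step_eqb (x y : step) : bool :=
  match x, y with
  | U, U | D, D | FL, FL | FR, FR => true
  | _, _ => false
  end.

Lemma step_eqP : Equality.axiom step_eqb.
Proof. by case; case; constructor. Qed.

HB.instance Definition _ := hasDecEq.Build step step_eqP.

Fixpoint motzkin_from (h : nat) (p : seq step) : bool :=
  match p with
  | [::] => h == 0
  | U :: p' => motzkin_from h.+1 p'
  | D :: p' => (0 < h) && motzkin_from h.-1 p'
  | FL :: p' => motzkin_from h p'
  | FR :: p' => motzkin_from h p'
  end.

Definition motzkinZ (m : nat) (Z : seq (seq step)) (p : seq step) : bool :=
  [&& size p == m, motzkin_from 0 p & all (fun w => ~~ infix w p) Z].

Fixpoint fmap (t : tree) : seq step :=
  match t with
  | Leaf => [::]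
  | Node Leaf Leaf => [::]
  | Node l Leaf => FL :: fmap l
  | Node Leaf r => FR :: fmap r
  | Node l r => U :: fmap r ++ D :: fmap l
  end.

Definition bij_between (A : tree -> Prop) (B : seq step -> Prop)
    (g : tree -> seq step) : Prop :=
  [/\ (forall T, A T -> B (g T)),
      (forall T T', A T -> A T' -> g T = g T' -> T = T') &
      (forall p, B p -> exists2 T, A T & g T = p)].

Fixpoint words (m : nat) : seq (seq step) :=
  match m with
  | 0 => [:: [::]]
  | m'.+1 => [seq s :: w | s <- [:: U; D; FL; FR], w <- words m']
  end.

Definition cardM (m : nat) (Z : seq (seq step)) : nat :=
  count (motzkinZ m Z) (words m).

(* OEIS A025242 (shifted so that a025242 1 = 1, a025242 2 = 2, ...):
   its generating function F(x) = sum_{n>=1} a(n) x^(n-1) satisfies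
   F = 1 + 2x F + x^2 F + x^3 F^2. *)
Definition A_next (l : seq nat) : nat :=
  let m := size l in
  if m is 0 then 1 else
  2 * nth 0 l (m - 1) + (if 2 <= m then nth 0 l (m - 2) else 0)
  + sumn [seq nth 0 l i * nth 0 l (m - 3 - i) | i <- iota 0 (m - 2)].

Fixpoint A_seq (k : nat) : seq nat :=
  match k with 0 => [::] | k'.+1 => rcons (A_seq k') (A_next (A_seq k')) end.

Definition a025242 (n : nat) : nat := nth 0 (A_seq n) n.-1.

Definition Z1 : seq (seq step) := [:: [:: U; U]; [:: U; FR]].
Definition Z2 : seq (seq step) := [:: [:: D; U]; [:: D; FL]].
Definition Z3 : seq (seq step) := [:: [:: U; U]; [:: FR; U]].
Definition Z4 : seq (seq step) :=
  [:: [:: U; U; U]; [:: U; U; FL]; [:: U; FR; U]; [:: U; FR; FL];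
      [:: FR; U; U]; [:: FR; U; FL]; [:: FR; FR; U]; [:: FR; FR; FL]].

(* Main.v *)
Require Import Defs.
From HB Require Import structures.
From mathcomp Require Import all_boot.
From mathcomp Require Import zify.

(** Every one of the four pattern classes consists of the trees in which no
    vertex is the root of a contiguous copy of P: a vertex in a subtree
    witnesses a child there, which shortens the edges marked "-", and in case
    (iv) one moreover slides the copy down a right chain.  Contiguous copies are
    local configurations, and since f(R(T)) is followed by D in f(T), each of
    them is visible in f(T) exactly as one of the words of Z.  As f is a
    bijection from trees on n vertices to 2-colored Motzkin paths with n - 1
    steps, it remains to count trees.  Let T count the avoiders, including the
    empty tree, by vertices, and put T = 1 + x F.  Cases (i) and (ii) are mirror
    images of each other, and decomposing at the root gives F = T + x F S with
    S = 1 + x T, whereas in cases (iii) and (iv) one gets F = T A with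
    A = 1 + x A + x^2 F.  In both situations F = 1 + 2x F + x^2 F + x^3 F^2. *)

Set Implicit Arguments.
Unset Strict Implicit.
Unset Printing Implicit Defensive.

(** * Decidable equality and mirror images of trees *)

Fixpoint tree_eqb (s t : tree) : bool :=
  match s, t with
  | Leaf, Leaf => true
  | Node l r, Node l' r' => tree_eqb l l' && tree_eqb r r'
  | _, _ => false
  end.

Lemma tree_eqP : Equality.axiom tree_eqb.
Proof.
elim=> [|l IHl r IHr] [|l' r'] /=; try by constructor.
case: (IHl l') => [<-|neq_l]; last by constructor=> -[].
by case: (IHr r') => [<-|neq_r]; constructor=> // -[].
Qed.

HB.instance Definition _ := hasDecEq.Build tree tree_eqP.

Definition is_leaf (t : tree) : bool := if t is Leaf then true else false.

Fixpoint mirror (t : tree) : tree :=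
  if t is Node l r then Node (mirror r) (mirror l) else Leaf.

Lemma mirrorK : involutive mirror.
Proof. by elim=> //= l -> r ->. Qed.

Lemma bt_size_mirror t : bt_size (mirror t) = bt_size t.
Proof. by elim: t => //= l -> r ->; rewrite addnC. Qed.

(** * Contiguous occurrences *)

(** Anchored occurrence: the root of the contiguous copy of [P] is the root of [t]. *)
Fixpoint embeds (P t : tree) : bool :=
  match P, t with
  | Leaf, _ => true
  | Node _ _, Leaf => false
  | Node pl pr, Node l r => embeds pl l && embeds pr r
  end.

Fixpoint avoids (P t : tree) : bool :=
  if t is Node l r then [&& ~~ embeds P t, avoids P l & avoids P r] else true.

Lemma embeds_mirror P t : embeds (mirror P) (mirror t) = embeds P t.
Proof. by elim: P t => [|pl IHl pr IHr] [|l r] //=; rewrite IHl IHr andbC. Qed.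

Lemma avoids_mirror P t : avoids (mirror P) (mirror t) = avoids P t.
Proof.
elim: t => //= l IHl r IHr.
by rewrite -(embeds_mirror P (Node l r)) /= IHl IHr [avoids P r && _]andbC.
Qed.

Lemma mem_addrs_node l r b a :
  (b :: a \in addrs (Node l r)) = (a \in addrs (if b then r else l)).
Proof.
rewrite /= inE /= mem_cat.
have inj c : injective (cons c : seq bool -> _) by move=> x y [].
have notin c s : (b :: a \in map (cons c) s) -> b = c by case/mapP=> x _ [].
case: b notin => notin; rewrite (mem_map (inj _)).
  by case: (boolP (_ \in map (cons false) _)) => [/notin|].
by rewrite orbC; case: (boolP (_ \in map (cons true) _)) => [/notin|].
Qed.

(** Ancestors of a vertex are vertices. This turns a vertex somewhere in a subtree into a child at
    the root of that subtree. *)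
Lemma mem_addrs_prefix t a b : prefix a b -> b \in addrs t -> a \in addrs t.
Proof.
move=> /prefixP[c ->].
elim: a t => [|d a IH] [|l r] //; rewrite cat_cons !mem_addrs_node; exact: IH.
Qed.

Lemma embedsP P t : reflect {subset addrs P <= addrs t} (embeds P t).
Proof.
apply: (iffP idP) => [|sub].
  elim: P t => [|pl IHl pr IHr] [|l r] // /andP[/IHl Hl /IHr Hr] [|b a] //.
  rewrite !mem_addrs_node; case: b; [exact: Hr | exact: Hl].
elim: P t sub => [|pl IHl pr IHr] [|l r] // sub; first by have := sub [::] isT.
apply/andP; split; [apply: IHl | apply: IHr] => a a_in.
  by rewrite -(mem_addrs_node l r false) sub // mem_addrs_node.
by rewrite -(mem_addrs_node l r true) sub // mem_addrs_node.
Qed.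

(** A contiguous copy is a translate of the address set of [P], and [a] is the address of its root.
    An empty [P] would occur vacuously even in [Leaf], hence the form [Node pl pr]. *)
Lemma occursP pl pr t (P := Node pl pr) :
  (exists a, forall x, x \in addrs P -> a ++ x \in addrs t) <-> ~~ avoids P t.
Proof.
split=> [[a]|].
  elim: a t => [|b a IH] [|l r] sub; try by have := sub [::] isT.
    by apply/negP => /= /andP[/negP[]]; apply/(embedsP P (Node l r)) => x /sub.
  have /IH : forall x, x \in addrs P -> a ++ x \in addrs (if b then r else l).
    by move=> x /sub; rewrite cat_cons mem_addrs_node.
  by rewrite /= -/P; case: b {sub} => /negPf ->; rewrite !(andbF, andFb).
elim: t => [|l IHl r IHr] // /nandP[|/nandP[/IHl|/IHr]].
- by rewrite negbK => /embedsP sub; exists [::].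
- by case=> a sub; exists (false :: a) => x /sub; rewrite cat_cons mem_addrs_node.
- by case=> a sub; exists (true :: a) => x /sub; rewrite cat_cons mem_addrs_node.
Qed.

(** Translation by [a] sends children to children, which satisfies an edge condition for either
    value of [e]. *)
Lemma contains_occurs P e t a :
  (forall x, x \in addrs P -> a ++ x \in addrs t) -> contains t (Pattern P e).
Proof.
move=> sub; exists (cat a); split=> //= [x y _ _ /eqP|p b _].
  by rewrite eqseq_cat // eqxx => /eqP.
by rewrite rcons_cat; case: ifP => // _; apply: prefix_refl.
Qed.

Lemma edge_prefix (c : bool) (x y : seq bool) b :
  (if c then y = rcons x b else prefix (rcons x b) y) -> prefix (rcons x b) y.
Proof. by case: c => // ->; apply: prefix_refl. Qed.

(** * Containment of the four patterns as contiguous occurrence *)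

Definition P2134 := Node (Node Leaf Leaf) (Node Leaf (Node Leaf Leaf)).
Definition P3214 := Node (Node (Node Leaf Leaf) Leaf) (Node Leaf Leaf).
Definition P1324 := Node Leaf (Node (Node Leaf Leaf) (Node Leaf Leaf)).
Definition P1243 := Node Leaf (Node Leaf (Node (Node Leaf Leaf) Leaf)).

(** The two free edges end in the leaves 1 and 4 of the pattern. The image of a leaf can be moved up
    to the first vertex of the subtree in which it lies, and no other vertex of the copy moves. The
    next two patterns are treated in the same way. *)
Lemma contains_2134 x z t :
  contains t (pat [:: 2; 1; 3; 4] [:: x; true; z]) <-> ~~ avoids P2134 t.
Proof.
split=> [[f [dom _ edge]]|/occursP[a]]; last exact: contains_occurs.
have /= f1 := edge [::] true isT.
have /= /edge_prefix f11 := edge [:: true] true isT.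
have /= /edge_prefix f0 := edge [::] false isT.
rewrite f1 in f11.
have in0 := mem_addrs_prefix f0 (dom [:: false] isT).
have in11 := mem_addrs_prefix f11 (dom [:: true; true] isT).
apply/occursP; exists (f [::]) => y; rewrite !inE /=.
case/or4P=> /eqP->; rewrite ?cats0 -?cat_rcons ?cats0 //.
- exact: (dom [::]).
- by rewrite -f1; apply: (dom [:: true]).
Qed.

Lemma contains_3214 y z t :
  contains t (pat [:: 3; 2; 1; 4] [:: true; y; z]) <-> ~~ avoids P3214 t.
Proof.
split=> [[f [dom _ edge]]|/occursP[a]]; last exact: contains_occurs.
have /= f0 := edge [::] false isT.
have /= /edge_prefix f00 := edge [:: false] false isT.
have /= /edge_prefix f1 := edge [::] true isT.
rewrite f0 in f00.
have in1 := mem_addrs_prefix f1 (dom [:: true] isT).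
have in00 := mem_addrs_prefix f00 (dom [:: false; false] isT).
apply/occursP; exists (f [::]) => x; rewrite !inE /=.
case/or4P=> /eqP->; rewrite ?cats0 -?cat_rcons ?cats0 //.
- exact: (dom [::]).
- by rewrite -f0; apply: (dom [:: false]).
Qed.

Lemma contains_1324 y z t :
  contains t (pat [:: 1; 3; 2; 4] [:: true; y; z]) <-> ~~ avoids P1324 t.
Proof.
split=> [[f [dom _ edge]]|/occursP[a]]; last exact: contains_occurs.
have /= f1 := edge [::] true isT.
have /= /edge_prefix f10 := edge [:: true] false isT.
have /= /edge_prefix f11 := edge [:: true] true isT.
rewrite f1 in f10 f11.
have in10 := mem_addrs_prefix f10 (dom [:: true; false] isT).
have in11 := mem_addrs_prefix f11 (dom [:: true; true] isT).
apply/occursP; exists (f [::]) => x; rewrite !inE /=.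
case/or4P=> /eqP->; rewrite ?cats0 -?cat_rcons ?cats0 //.
- exact: (dom [::]).
- by rewrite -f1; apply: (dom [:: true]).
Qed.

(** If [s] starts with a right step, [a] is moved one step to the right. If it starts with a left
    step, the vertex wanted is already an ancestor of the given one. *)
Lemma slide_right_chain t a s :
  a ++ [:: true; true] ++ s ++ [:: false] \in addrs t ->
  exists a', a' ++ [:: true; true; false] \in addrs t.
Proof.
elim: s a => [|[] s IH] a; first by exists a.
  by move=> a_in; apply: (IH (rcons a true)); rewrite cat_rcons.
move=> a_in; exists a; apply: mem_addrs_prefix a_in.
by rewrite prefix_catr ?eqxx //= prefix0s.
Qed.

Lemma contains_1243 y z t :
  contains t (pat [:: 1; 2; 4; 3] [:: true; y; z]) <-> ~~ avoids P1243 t.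
Proof.
split=> [[f [dom _ edge]]|/occursP[a]]; last exact: contains_occurs.
have /= f1 := edge [::] true isT.
have /= /edge_prefix f11 := edge [:: true] true isT.
have /= /edge_prefix f110 := edge [:: true; true] false isT.
(* Here [s] is the path from the right child of f(2) down to f(4). The image of 3 shows that f(4)
   has a left child. *)
rewrite f1 in f11; have /prefixP[s f11E] := f11; rewrite f11E in f110.
have in110 := mem_addrs_prefix f110 (dom [:: true; true; false] isT).
have [|a a_in] := @slide_right_chain t (f [::]) s.
  by rewrite -!cats1 -!catA in in110.
apply/occursP; exists a => x; rewrite !inE /= => x_in.
(* [P1243] is a path, so all its addresses are prefixes of the deepest one. *)
apply: mem_addrs_prefix a_in; rewrite prefix_catr // eqxx.
by case/or4P: x_in => /eqP->.
Qed.

(** * The bijection with Motzkin paths *)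

Lemma fmap_node l r :
  fmap (Node l r) =
    if is_leaf l then (if is_leaf r then [::] else FR :: fmap r)
    else if is_leaf r then FL :: fmap l else U :: fmap r ++ D :: fmap l.
Proof. by case: l r => [|? ?] [|? ?]. Qed.

Arguments fmap : simpl never.

Lemma size_fmap t : size (fmap t) = (bt_size t).-1.
Proof.
elim: t => // l IHl r IHr; rewrite fmap_node.
case: l r IHl IHr => [|a b] [|c d] //= IHl IHr;
  rewrite ?size_cat /= ?IHl ?IHr /=; lia.
Qed.

Lemma motzkin_from_cat h p q :
  motzkin_from 0 p -> motzkin_from h q -> motzkin_from h (p ++ q).
Proof.
(* Generalised for the induction: [p] starts at height k and [p ++ q] at height k + h. *)
move=> + mq; rewrite -[X in motzkin_from X (_ ++ _)]add0n.
elim: p 0 => [|s p IH] k /=; first by move/eqP->.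
case: s => [/IH|/andP[k0 /IH]|/IH|/IH] //.
by rewrite addn_gt0 k0 /= -!subn1 addnBAC.
Qed.

Lemma motzkin_fmap t : motzkin_from 0 (fmap t).
Proof.
elim: t => // l IHl r IHr; rewrite fmap_node.
by case: (is_leaf l); case: (is_leaf r) => //=; apply: motzkin_from_cat.
Qed.

(** Started at height [h], both [p] and [p'] end on the axis without going below it, so the [D] that
    follows is the first step below the axis, and its position is determined. *)
Lemma motzkin_split_uniq h p q p' q' :
  motzkin_from h p -> motzkin_from h p' -> p ++ D :: q = p' ++ D :: q' ->
  p = p' /\ q = q'.
Proof.
elim: p p' h => [|s p IH] [|s' p'] h /=.
- by move=> _ _ [->].
- by case: s' => // /eqP->.
- by case: s => // /[swap] /eqP->.
- move=> mp mp' [eq_s eq_t]; rewrite -{s'}eq_s in mp' *.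
  case: s mp mp' => [mp mp'|/andP[_ mp] /andP[_ mp']|mp mp'|mp mp'];
    by have [-> ->] := IH _ _ mp mp' eq_t.
Qed.

(** First-passage decomposition: the path is cut where it first descends to height [h]. After an
    initial [U] two levels have to be lost, so the induction hypothesis is used twice, the second
    time on a remainder; hence the induction on the length. *)
Lemma motzkin_split h p : motzkin_from h.+1 p ->
  exists q r, [/\ p = q ++ D :: r, motzkin_from 0 q & motzkin_from h r].
Proof.
elim: {p}(size p) {-2}p (leqnn (size p)) h => [|n IH] [|s p] //= sz h.
case: s => /=.
- move=> /(IH _ sz)[q [r [pE mq mr]]].
  have /IH/(_ _ mr)[q' [r' [rE mq' mr']]] : size r <= n.
    by move: sz; rewrite pE size_cat /=; lia.
  exists (U :: q ++ D :: q'), r'; split=> //; last exact: motzkin_from_cat.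
  by rewrite pE rE /= -catA.
- by move=> mp; exists [::], p.
- by move=> /(IH _ sz)[q [r [-> mq mr]]]; exists (FL :: q), r.
- by move=> /(IH _ sz)[q [r [-> mq mr]]]; exists (FR :: q), r.
Qed.

(** The hypotheses on sizes separate the empty tree from the single vertex, since [fmap] sends both
    to the empty path. *)
Lemma fmap_inj t t' :
  0 < bt_size t -> 0 < bt_size t' -> fmap t = fmap t' -> t = t'.
Proof.
elim: t t' => // l IHl r IHr [|l' r'] // _ _; rewrite !fmap_node.
have pos s : ~~ is_leaf s -> 0 < bt_size s by case: s.
have leafE s : is_leaf s -> s = Leaf by case: s.
case: (boolP (is_leaf l)) => [/leafE->|/pos l0];
  case: (boolP (is_leaf r)) => [/leafE->|/pos r0];
  case: (boolP (is_leaf l')) => [/leafE->|/pos l'0];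
  case: (boolP (is_leaf r')) => [/leafE->|/pos r'0] // [].
- by move/IHr=> ->.
- by move/IHl=> ->.
- case/(motzkin_split_uniq (motzkin_fmap r) (motzkin_fmap r')).
  by move=> /IHr-> // /IHl->.
Qed.

Lemma fmap_surj p : motzkin_from 0 p -> exists2 t, 0 < bt_size t & fmap t = p.
Proof.
have not_leaf t : 0 < bt_size t -> is_leaf t = false by case: t.
elim: {p}(size p) {-2}p (leqnn (size p)) => [|n IH] [|s p] //= sz;
  try by exists (Node Leaf Leaf).
case: s => //= [/motzkin_split[q [r [pE mq mr]]]
               |/(IH _ sz)[t t0 tE]|/(IH _ sz)[t t0 tE]].
- have sz' : size q <= n /\ size r <= n.
    by move: sz; rewrite pE size_cat /=; lia.
  have [t t0 tE] := IH q sz'.1 mq; have [u u0 uE] := IH r sz'.2 mr.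
  by exists (Node u t) => //; rewrite fmap_node !not_leaf // tE uE pE.
- by exists (Node t Leaf) => //; rewrite fmap_node (not_leaf t t0) /= tE.
- by exists (Node Leaf t) => //; rewrite fmap_node (not_leaf t t0) /= tE.
Qed.

(** * Forbidden words inside f(T) *)

Lemma infix_consl (w : seq step) s p :
  infix w (s :: p) = prefix w (s :: p) || infix w p.
Proof. by []. Qed.

Lemma prefix_catD w p q : D \notin w -> prefix w (p ++ D :: q) = prefix w p.
Proof.
elim: p w => [|s p IH] [|x w] //=; rewrite ?prefix0s // inE negb_or => /andP[xD wD].
  by rewrite eq_sym (negPf xD).
by rewrite IH.
Qed.

(** A word without [D] cannot straddle the marked [D]. *)
Lemma infix_catD w p q : w != [::] -> D \notin w ->
  infix w (p ++ D :: q) = infix w p || infix w q.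
Proof.
move=> w0 wD; elim: p => [|s p IH].
  case: w w0 wD => // x w _; rewrite inE negb_or => /andP[xD _].
  by rewrite cat0s infix_consl /= eq_sym (negPf xD).
by rewrite cat_cons !infix_consl IH orbA -cat_cons prefix_catD.
Qed.

(** An occurrence that starts inside [p] cannot reach the marked [D], as only its first letter is
    [D]; otherwise it starts at the marked [D] or later. *)
Lemma infix_D_catD w p q : D \notin w ->
  infix (D :: w) (p ++ D :: q) =
    [|| infix (D :: w) p, prefix w q | infix (D :: w) q].
Proof.
move=> wD; elim: p => [|s p IH]; first by rewrite cat0s infix_consl.
by rewrite cat_cons !infix_consl IH /= prefix_catD // -!orbA.
Qed.

Lemma prefix_U_fmap w l r : D \notin w ->
  prefix (U :: w) (fmap (Node l r)) =
    [&& ~~ is_leaf l, ~~ is_leaf r & prefix w (fmap r)].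
Proof.
by move=> wD; rewrite fmap_node; case: ifP; case: ifP => //=; rewrite prefix_catD.
Qed.

Lemma prefix_FL_fmap w l r :
  prefix (FL :: w) (fmap (Node l r)) =
    [&& ~~ is_leaf l, is_leaf r & prefix w (fmap l)].
Proof. by rewrite fmap_node; case: ifP; case: ifP. Qed.

Lemma prefix_FR_fmap w l r :
  prefix (FR :: w) (fmap (Node l r)) =
    [&& is_leaf l, ~~ is_leaf r & prefix w (fmap r)].
Proof. by rewrite fmap_node; case: ifP; case: ifP. Qed.

(** An occurrence that does not use the first letter lies in the path of one subtree, because the
    [D] at the root separates the two paths. *)
Lemma infix_fmap w l r : w != [::] -> D \notin w ->
  infix w (fmap (Node l r)) =
    [|| prefix w (fmap (Node l r)), infix w (fmap l) | infix w (fmap r)].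
Proof.
move=> w0 wD; have infix0 : infix w (fmap Leaf) = false by case: w w0 {wD}.
rewrite fmap_node.
case: l r => [|a b] [|c d]; rewrite /is_leaf.
- by case: w w0 {wD infix0}.
- by rewrite infix_consl infix0.
- by rewrite infix_consl infix0 orbF.
- by rewrite infix_consl infix_catD // [infix _ _ || _]orbC.
Qed.

Lemma infix_D_fmap w l r : D \notin w ->
  infix (D :: w) (fmap (Node l r)) =
    [|| [&& ~~ is_leaf l, ~~ is_leaf r & prefix w (fmap l)],
        infix (D :: w) (fmap l) | infix (D :: w) (fmap r)].
Proof.
move=> wD; rewrite fmap_node.
case: l r => [|a b] [|c d]; rewrite /is_leaf //.
- by rewrite infix_consl orbF.
- by rewrite infix_consl infix_D_catD // [infix _ _ || _]orbC -orbA.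
Qed.

Definition avoids_words (Z : seq (seq step)) (p : seq step) : bool :=
  all (fun w => ~~ infix w p) Z.

(** Reduces avoidance to a test at the root: some word of [Z] begins f(T) exactly when [P] embeds at
    the root of T. *)
Lemma avoids_words_fmap Z P :
  all (fun w => (w != [::]) && (D \notin w)) Z ->
  (forall l r, has (fun w => prefix w (fmap (Node l r))) Z =
               embeds P (Node l r)) ->
  forall t, avoids_words Z (fmap t) = avoids P t.
Proof.
move=> /allP Zok ZP; elim=> [|l IHl r IHr].
  by apply/allP => w /Zok; case: w.
rewrite [avoids _ _]/= -IHl -IHr -ZP -all_predC -!all_predI.
apply: eq_in_all => w /Zok /andP[w0 wD] /=.
by rewrite infix_fmap // !negb_or.
Qed.

(** The letter [U] says that the root has two children. The path then continues in the right
    subtree, where an initial [U] or [FR] says that there is a right child. *)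
Lemma avoids_words_Z1 t : avoids_words Z1 (fmap t) = avoids P2134 t.
Proof.
apply: avoids_words_fmap => // l r; rewrite /= !prefix_U_fmap //.
by case: l r => [|? ?] [|[|? ?] [|? ?]] //=;
  rewrite ?prefix_U_fmap ?prefix_FR_fmap ?prefix0s.
Qed.

(** The [D] of a vertex with two children is followed by the path of its left subtree, and an
    initial [U] or [FL] there says that there is a left child. As the words contain [D], the root
    test above is replaced by [infix_D_fmap]. *)
Lemma avoids_words_Z2 t : avoids_words Z2 (fmap t) = avoids P3214 t.
Proof.
elim: t => // l IHl r IHr; rewrite [avoids _ _]/= -IHl -IHr.
rewrite /avoids_words /= !infix_D_fmap // !andbT !negb_or.
(* The occurrences inside subtrees become arbitrary Booleans, which leaves a Boolean identity. *)
set il1 := infix _ _; set ir1 := infix _ _; set il2 := infix _ _.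
set ir2 := infix _ _; move: il1 ir1 il2 ir2 {IHl IHr} => il1 ir1 il2 ir2.
case: l r => [|[|? ?] [|? ?]] [|? ?] //;
  rewrite ?prefix_U_fmap ?prefix_FL_fmap ?prefix0s //=;
  by case: il1 ir1 il2 ir2 => [] [] [] [].
Qed.

(** A first letter [U] or [FR] means that there is a right child, and a [U] after it that this child
    has two children. *)
Lemma avoids_words_Z3 t : avoids_words Z3 (fmap t) = avoids P1324 t.
Proof.
apply: avoids_words_fmap => // l r; rewrite /= !(prefix_U_fmap, prefix_FR_fmap) //.
by case: l r => [|? ?] [|[|? ?] [|? ?]] //=; rewrite ?prefix_U_fmap ?prefix0s.
Qed.

(** The first two letters follow two right edges, and a third letter [U] or [FL] gives a left child
    at their end. *)
Lemma avoids_words_Z4 t : avoids_words Z4 (fmap t) = avoids P1243 t.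
Proof.
apply: avoids_words_fmap => // l r; rewrite /= !(prefix_U_fmap, prefix_FR_fmap) //.
by case: l r => [|? ?] [|[|? ?] [|[|? ?] [|? ?]]] //=;
  rewrite ?prefix_U_fmap ?prefix_FR_fmap ?prefix_FL_fmap ?prefix0s //=;
  rewrite ?prefix_U_fmap ?prefix_FR_fmap ?prefix_FL_fmap ?prefix0s.
Qed.

Lemma fmap_bij_between n Pe P Z : 0 < n ->
  (forall t, contains t Pe <-> ~~ avoids P t) ->
  (forall t, avoids_words Z (fmap t) = avoids P t) ->
  bij_between (avoider n Pe) (fun p => motzkinZ n.-1 Z p) fmap.
Proof.
move=> n0 PeP ZP.
have avP t : avoider n Pe t <-> bt_size t = n /\ avoids P t.
  by rewrite /avoider; split=> -[tn];
    [move/PeP/negP; rewrite negbK | move=> av; split=> // /PeP/negP].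
split=> [t /avP[tn av]|t t' /avP[tn _] /avP[t'n _]|p /and3P[/eqP pn mp pZ]].
- by rewrite /motzkinZ size_fmap tn eqxx motzkin_fmap -/(avoids_words _ _) ZP.
- by apply: fmap_inj; rewrite ?tn ?t'n.
- have [t t0 tp] := fmap_surj mp; exists t => //.
  by apply/avP; rewrite -ZP tp; split=> //; move: t0 pn; rewrite -tp size_fmap; lia.
Qed.

(** * Counting trees *)

Fixpoint trees_fuel (k n : nat) : seq tree :=
  match k, n with
  | _, 0 => [:: Leaf]
  | 0, _ => [::]
  | k'.+1, n'.+1 =>
      flatten [seq [seq Node l r | l <- trees_fuel k' i,
                                   r <- trees_fuel k' (n' - i)]
              | i <- iota 0 n]
  end.

Definition trees (n : nat) : seq tree := trees_fuel n n.

Lemma trees_fuelS k n :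
  trees_fuel k.+1 n.+1 =
    flatten [seq [seq Node l r | l <- trees_fuel k i, r <- trees_fuel k (n - i)]
            | i <- iota 0 n.+1].
Proof. by []. Qed.

Lemma trees_fuelE k n : n <= k -> trees_fuel k n = trees n.
Proof.
elim: n {-2}n (leqnn n) k => [|m IH] [|n] // nm [|k] // nk.
rewrite /trees !trees_fuelS; congr flatten; apply/eq_in_map => i.
rewrite mem_iota => i_le.
by rewrite !(IH _ _ k) ?(IH _ _ n) //; lia.
Qed.

Lemma treesS n :
  trees n.+1 = flatten [seq [seq Node l r | l <- trees i, r <- trees (n - i)]
                       | i <- iota 0 n.+1].
Proof.
rewrite {1}/trees trees_fuelS; congr flatten; apply/eq_in_map => i.
by rewrite mem_iota => i_le; rewrite !trees_fuelE //; lia.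
Qed.

Lemma mem_trees t n : (t \in trees n) = (bt_size t == n).
Proof.
elim: t n => [|l IHl r IHr] [|n] //.
  rewrite treesS; apply/negbTE/flattenP => -[s /mapP[i _ ->]].
  by case/allpairsPdep=> l [r [_ _]].
rewrite treesS; apply/flatten_mapP/eqP => [[i]|[<-]].
  rewrite mem_iota => i_le /allpairsPdep[l' [r' [lE rE [ll rr]]]].
  by move: lE rE; rewrite -ll -rr IHl IHr /=; lia.
exists (bt_size l); first by rewrite mem_iota; lia.
by apply: allpairs_f; rewrite ?IHl ?IHr //; lia.
Qed.

Lemma count_treesS (p : pred tree) n :
  count p (trees n.+1) =
    \sum_(i < n.+1) \sum_(l <- trees i) \sum_(r <- trees (n - i)) p (Node l r).
Proof.
rewrite treesS count_flatten -map_comp sumnE big_map -[n.+1]subn0.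
rewrite -/(index_iota 0 n.+1) big_mkord; apply: eq_bigr => i _ /=.
rewrite /allpairs_dep count_flatten -map_comp sumnE big_map.
by apply: eq_bigr => l _ /=; rewrite count_map -sum1_count big_mkcond.
Qed.

(** The counting series of [p] on nonempty trees is x times the product of the series of [q] and
    [s]. *)
Lemma count_treesM (p q s : pred tree) n :
  (forall l r, p (Node l r) = q l && s r) ->
  count p (trees n.+1) =
    \sum_(i < n.+1) count q (trees i) * count s (trees (n - i)).
Proof.
move=> pE; rewrite count_treesS; apply: eq_bigr => i _.
rewrite -!sum1_count big_distrlr /= [RHS]big_mkcond; apply: eq_bigr => l _.
rewrite [in RHS]big_mkcond /=; case: (boolP (q l)) => ql.
  by apply: eq_bigr => r _; rewrite pE ql; case: (s r).
by rewrite big1 // => r _; rewrite pE (negPf ql).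
Qed.

(** The multiplicity of [Node l r] is a convolution of the multiplicities of [l] and [r], in which
    only the index [bt_size l] can contribute. *)
Lemma uniq_trees n : uniq (trees n).
Proof.
apply: count_mem_uniq => t; rewrite mem_trees.
elim: t n => [|l IHl r IHr] [|n] //.
  rewrite (@count_treesM _ pred0 pred0) //.
  by rewrite big1 // => i _; rewrite count_pred0.
rewrite (@count_treesM _ (pred1 l) (pred1 r)) //.
rewrite [LHS](eq_bigr (fun i : 'I_n.+1 => (bt_size l == i) * (bt_size r == n - i)));
  last by move=> i _; rewrite IHl IHr.
have [le_ln|lt_nl] := leqP (bt_size l) n.
  have lt_ln : bt_size l < n.+1 by [].
  rewrite (bigD1 (Ordinal lt_ln)) //= eqxx mul1n big1 ?addn0; last first.
    by move=> i; rewrite -val_eqE /= eq_sym => /negPf->.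
  by congr nat_of_bool; apply/eqP/eqP; lia.
rewrite big1 => [|i _]; last first.
  by rewrite (_ : _ == _ = false) //; have := ltn_ord i; lia.
by rewrite (_ : _ == _ = false) //=; lia.
Qed.

Lemma count_trees_mirror (p : pred tree) n :
  count (fun t => p (mirror t)) (trees n) = count p (trees n).
Proof.
rewrite -count_map; apply/permP: p; apply: uniq_perm.
- by rewrite (map_inj_uniq (inv_inj mirrorK)) uniq_trees.
- exact: uniq_trees.
- move=> t; rewrite -{1}[t]mirrorK (mem_map (inv_inj mirrorK)) !mem_trees.
  by rewrite bt_size_mirror.
Qed.

(** * From counting paths to counting trees *)

Lemma mem_words m w : (w \in words m) = (size w == m).
Proof.
elim: m w => [|m IH] [|s w] //.
  by apply/negbTE/allpairsP => -[[? ?] []].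
apply/allpairsP/eqP => /= [[[s' w'] /= [_ + [_ eq_w]]]|[sw]].
  by rewrite -eq_w IH => /eqP->.
by exists (s, w); rewrite IH sw eqxx; split=> //; case: s.
Qed.

Lemma uniq_words m : uniq (words m).
Proof.
by elim: m => // m IH; apply: allpairs_uniq => // -[s w] [s' w'] _ _ /= [-> ->].
Qed.

Lemma cardM_count_trees P Z n :
  (forall t, avoids_words Z (fmap t) = avoids P t) ->
  cardM n Z = count (avoids P) (trees n.+1).
Proof.
move=> ZP; rewrite /cardM -!size_filter -(size_map fmap).
apply/perm_size/uniq_perm.
- exact/filter_uniq/uniq_words.
- rewrite map_inj_in_uniq; first exact/filter_uniq/uniq_trees.
  move=> t t'; rewrite !mem_filter !mem_trees.
  by move=> /andP[_ /eqP tn] /andP[_ /eqP t'n]; apply: fmap_inj; rewrite ?tn ?t'n.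
move=> p; rewrite mem_filter mem_words; apply/andP/mapP => [[]|[t]].
  case/and3P=> /eqP pn mp pZ _; have [t t0 tp] := fmap_surj mp; exists t => //.
  rewrite mem_filter -ZP tp mem_trees; apply/andP; split=> //.
  by move: pn; rewrite -tp size_fmap; lia.
rewrite mem_filter mem_trees -ZP => /andP[av /eqP tn] ->.
by rewrite /motzkinZ size_fmap tn motzkin_fmap eqxx.
Qed.

Lemma count_is_leaf n : count is_leaf (trees n) = (n == 0).
Proof.
case: n => // n; rewrite (@count_treesM _ pred0 pred0) //.
by rewrite big1 // => i _; rewrite count_pred0.
Qed.

Lemma count_not_leaf (q : pred tree) n :
  count (fun t => ~~ is_leaf t && q t) (trees n) =
    if n is 0 then 0 else count q (trees n).
Proof.
case: n => // n; apply: eq_in_count => t.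
by rewrite mem_trees; case: t.
Qed.

Lemma count_split (T : Type) (a p : pred T) s :
  count p s = count (fun t => a t && p t) s + count (fun t => ~~ a t && p t) s.
Proof. by elim: s => //= t s ->; case: (a t) => /=; lia. Qed.

(** The counting series of [is_leaf] is 1, the unit of convolution. *)
Lemma sum_count_leaf (g : nat -> nat) n :
  \sum_(i < n.+1) count is_leaf (trees i) * g (n - i) = g n.
Proof.
rewrite big_ord_recl count_is_leaf mul1n subn0 big1 ?addn0 // => i _.
by rewrite count_is_leaf.
Qed.

(** * The recurrence of A025242 *)

Lemma size_A_seq k : size (A_seq k) = k.
Proof. by elim: k => //= k IH; rewrite size_rcons IH. Qed.

Lemma nth_A_seq k i : i < k -> nth 0 (A_seq k) i = a025242 i.+1.
Proof.
elim: k => // k IH; rewrite ltnS leq_eqVlt => /predU1P[->|lt_ik] //.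
by rewrite /= nth_rcons size_A_seq lt_ik IH.
Qed.

Lemma a025242S n : a025242 n.+1 = A_next (A_seq n).
Proof. by rewrite /a025242 /= nth_rcons size_A_seq ltnn eqxx. Qed.

Lemma a025242_rec n :
  a025242 n.+3 = 2 * a025242 n.+2 + a025242 n.+1
                 + \sum_(i < n) a025242 i.+1 * a025242 (n - i).
Proof.
rewrite a025242S /A_next size_A_seq !nth_A_seq; try lia.
have -> : (n.+2 - 1).+1 = n.+2 by lia.
have -> : (n.+2 - 2).+1 = n.+1 by lia.
have -> : n.+2 - 2 = n by lia.
congr (_ + _); rewrite sumnE big_map -[n in iota 0 n]subn0.
rewrite -/(index_iota 0 n) big_mkord; apply: eq_bigr => i _.
have i_lt := ltn_ord i; rewrite !nth_A_seq; try lia.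
by congr (_ * a025242 _); lia.
Qed.

(** The hypotheses are the coefficients of F = 1 + 2x F + x^2 F + x^3 F^2. *)
Lemma a025242_unique (F : nat -> nat) :
  F 0 = 1 -> F 1 = 2 ->
  (forall n, F n.+2 = 2 * F n.+1 + F n + \sum_(i < n) F i * F (n - i.+1)) ->
  forall n, F n = a025242 n.+1.
Proof.
move=> F0 F1 FS n.
elim: n {-2}n (leqnn n) => [|m IH] [|[|n]] //= nm.
rewrite FS a025242_rec !IH; try lia.
congr (_ + _); apply: eq_bigr => i _; have i_lt := ltn_ord i.
by rewrite !IH; try lia; congr (_ * a025242 _); lia.
Qed.

(** Substituting S = 1 + x + x^2 F and T = 1 + x F into F = T + x F S gives the equation for F. *)
Lemma a025242_system1 (T S : nat -> nat) :
  T 0 = 1 -> S 0 = 1 -> (forall n, S n.+1 = T n) ->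
  (forall n, T n.+1 = T n + \sum_(i < n) T i.+1 * S (n - i.+1)) ->
  forall n, T n.+1 = a025242 n.+1.
Proof.
move=> T0 S0 SS TS; have T1 : T 1 = 1 by rewrite TS big_ord0 T0.
apply: (a025242_unique (F := fun n => T n.+1)) => //.
  by rewrite TS big_ord_recl big_ord0 /= T1 S0.
(* The last two summands carry [S 0] = 1 and [S 1] = [T 0] = 1 and give [T n.+2] and [T n.+1]. In
   the others [S] is a shift of [T]. *)
move=> n; rewrite TS big_ord_recr /= subnn S0 muln1.
rewrite big_ord_recr /= subSnn SS T0 muln1 addnCA !addnA.
set s1 := (\sum_(i < n) _); set s2 := (\sum_(i < n) _).
suff -> : s1 = s2 by lia.
apply: eq_bigr => i _; have i_lt := ltn_ord i.
have -> : n.+2 - i.+1 = (n - i.+1).+2 by lia.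
by rewrite SS.
Qed.

(** Multiplying A = 1 + x A + x^2 F by T and using F = T A gives F = T + x F + x^2 T F; then T = 1 +
    x F is substituted. *)
Lemma a025242_system2 (T A : nat -> nat) :
  T 0 = 1 -> A 0 = 1 -> A 1 = 1 -> (forall n, A n.+2 = A n.+1 + T n.+1) ->
  (forall n, T n.+1 = \sum_(i < n.+1) T i * A (n - i)) ->
  forall n, T n.+1 = a025242 n.+1.
Proof.
move=> T0 A0 A1 AS TS.
have T1 : T 1 = 1 by rewrite TS big_ord_recl big_ord0 /= T0 A0.
apply: (a025242_unique (F := fun n => T n.+1)) => //.
  by rewrite TS !big_ord_recl big_ord0 /= T0 T1 A0 A1.
move=> n; rewrite TS big_ord_recr /= subnn A0 muln1.
rewrite big_ord_recr /= subSnn A1 muln1.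
rewrite (eq_bigr (fun i : 'I_n.+1 => T i * A (n.+1 - i) + T i * T (n - i).+1));
  last first.
  move=> i _; have i_lt := ltn_ord i; rewrite -mulnDr; congr (_ * _).
  have -> : n.+2 - i = (n - i).+2 by lia.
  by rewrite AS; congr (A _ + _); lia.
rewrite big_split /=.
(* The first of the two sums, completed by [T n.+1], is [T n.+2]. The term of index 0 split off from
   the second sum supplies another [T n.+1]. *)
have := TS n.+1; rewrite big_ord_recr /= subnn A0 muln1.
rewrite [\sum_(i < n.+1) T i * T _]big_ord_recl /= T0 mul1n subn0.
rewrite (eq_bigr (fun i : 'I_n => T i.+1 * T (n - i.+1).+1)) //.
lia.
Qed.

(** * Root decompositions of the four classes *)

Lemma count_2134 n : count (avoids P2134) (trees n.+1) = a025242 n.+1.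
Proof.
pose no_right t := if t is Node _ r then is_leaf r else true.
pose no_left t := if t is Node l _ then is_leaf l else true.
(* Below a root with a left child, the right subtree must avoid the pattern and have no right child
   at its own root. *)
pose S n := count (fun t => no_right t && avoids P2134 t) (trees n).
apply: (a025242_system1
  (T := fun n => count (avoids P2134) (trees n)) (S := S)) => //.
  move=> m; rewrite /S (@count_treesM _ (avoids P2134) is_leaf); last first.
    by move=> [|? ?] [|? ?] //=; rewrite !(andbT, andbF).
  rewrite -[RHS](sum_count_leaf (fun i => count (avoids P2134) (trees i))).
  (* Reversal moves the [is_leaf] factor from the right to the left. *)
  rewrite (reindex_inj rev_ord_inj); apply: eq_bigr => i _ /=.
  have i_lt := ltn_ord i; rewrite subSS mulnC; congr (count _ (trees _) * _).
  by lia.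
(* Without a left child at the root, the right subtree is any avoider. *)
move=> m; rewrite (count_split no_left); congr (_ + _).
  rewrite (@count_treesM _ is_leaf (avoids P2134)); last by move=> [].
  exact: (sum_count_leaf (fun i => count (avoids P2134) (trees i))).
rewrite (@count_treesM _ (fun t => ~~ is_leaf t && avoids P2134 t)
                         (fun t => no_right t && avoids P2134 t)).
  rewrite big_ord_recl count_not_leaf add0n; apply: eq_bigr => i _.
  by rewrite count_not_leaf.
by move=> [|a b] [|c [|d e]] //=; rewrite ?andbT // !andbF.
Qed.

(** [P3214] is the mirror image of [P2134]. *)
Lemma count_3214 n : count (avoids P3214) (trees n.+1) = a025242 n.+1.
Proof.
rewrite -count_2134 -count_trees_mirror; apply: eq_count => t.
exact: (avoids_mirror P2134 t).
Qed.

Lemma count_1324 n : count (avoids P1324) (trees n.+1) = a025242 n.+1.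
Proof.
pose cherry := Node (Node Leaf Leaf) (Node Leaf Leaf).
(* [P1324] occurs at the root exactly when the right subtree has two children at its root, so right
   subtrees are counted by [A]. A nonempty tree counted by [A] either has no left child, and its
   right subtree is again counted by [A], or has a left child only. *)
pose A n := count (fun t => ~~ embeds cherry t && avoids P1324 t) (trees n).
pose no_left t := if t is Node l _ then is_leaf l else true.
apply: (a025242_system2
  (T := fun n => count (avoids P1324) (trees n)) (A := A)) => //.
  move=> m; rewrite /A (count_split no_left); congr (_ + _).
    rewrite (@count_treesM _ is_leaf
      (fun t => ~~ embeds cherry t && avoids P1324 t)).
      exact: sum_count_leaf A m.+1.
    by move=> [].
  rewrite (@count_treesM _ (fun t => ~~ is_leaf t && avoids P1324 t) is_leaf).
    pose G i := if i is 0 then 0 else count (avoids P1324) (trees i).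
    rewrite -[RHS]/(G m.+1) -(sum_count_leaf G).
    rewrite (reindex_inj rev_ord_inj); apply: eq_bigr => i _.
    rewrite count_not_leaf mulnC /=; have i_lt := ltn_ord i.
    have -> : m.+1 - (m.+2 - i.+1) = i by lia.
    by rewrite subSS.
  by move=> [|? ?] [|? ?] //=; rewrite !(andbT, andbF).
move=> m; apply: count_treesM => l r.
by rewrite /= [avoids _ l && _]andbC andbA andbC.
Qed.

Lemma count_1243 n : count (avoids P1243) (trees n.+1) = a025242 n.+1.
Proof.
pose Q := Node Leaf (Node (Node Leaf Leaf) Leaf).
pose no_left t := if t is Node l _ then is_leaf l else true.
(* [P1243] occurs at the root exactly when [Q] embeds in the right subtree, so right subtrees
   satisfy [inA]. *)
pose inA t := ~~ embeds Q t && avoids P1243 t.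
pose inB t := no_left t && inA t.
pose T n := count (avoids P1243) (trees n).
pose A n := count inA (trees n).
(* The trees satisfying [inB] are the right chains, one of each size. *)
have B1 m : count inB (trees m) = 1.
  elim: m => // m IH; rewrite (@count_treesM _ is_leaf inB).
    by rewrite (sum_count_leaf (fun i => count inB (trees i))).
  by move=> [|? ?] [|[|? ?] c].
(* An arbitrary avoider on the left and a right chain on the right. *)
have AS m : A m.+1 = \sum_(i < m.+1) T i.
  rewrite /A (@count_treesM _ (avoids P1243) inB).
    by apply: eq_bigr => i _; rewrite B1 muln1.
  move=> l r; rewrite /inB /inA /=.
  by case: r => [|[|? ?] c] /=; rewrite ?andbT ?andbF //= andbCA.
apply: (a025242_system2 (T := T) (A := A)) => //.
- by move=> m; rewrite !AS big_ord_recr.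
- move=> m; apply: count_treesM => l r.
  by rewrite /inA /= [avoids _ l && _]andbC andbA andbC.
Qed.

Theorem theorem12 :
  (forall n, 1 <= n ->
     [/\ bij_between (avoider n (pat [:: 2; 1; 3; 4] [:: true; true; true]))
                     (fun p => motzkinZ n.-1 Z1 p) fmap,
         bij_between (avoider n (pat [:: 3; 2; 1; 4] [:: true; true; true]))
                     (fun p => motzkinZ n.-1 Z2 p) fmap,
         bij_between (avoider n (pat [:: 1; 3; 2; 4] [:: true; true; true]))
                     (fun p => motzkinZ n.-1 Z3 p) fmap &
         bij_between (avoider n (pat [:: 1; 2; 4; 3] [:: true; true; true]))
                     (fun p => motzkinZ n.-1 Z4 p) fmap]) /\
  (forall (n : nat) (x y z : bool) (T : tree), 1 <= n -> bt_size T = n ->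
     [/\ (avoider n (pat [:: 2; 1; 3; 4] [:: x; true; z]) T
           <-> avoider n (pat [:: 2; 1; 3; 4] [:: true; true; true]) T),
         (avoider n (pat [:: 3; 2; 1; 4] [:: true; y; z]) T
           <-> avoider n (pat [:: 3; 2; 1; 4] [:: true; true; true]) T),
         (avoider n (pat [:: 1; 3; 2; 4] [:: true; y; z]) T
           <-> avoider n (pat [:: 1; 3; 2; 4] [:: true; true; true]) T) &
         (avoider n (pat [:: 1; 2; 4; 3] [:: true; y; z]) T
           <-> avoider n (pat [:: 1; 2; 4; 3] [:: true; true; true]) T)]) /\
  (forall n, 1 <= n ->
     [/\ cardM n.-1 Z1 = a025242 n, cardM n.-1 Z2 = a025242 n,
         cardM n.-1 Z3 = a025242 n & cardM n.-1 Z4 = a025242 n]) /\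
  [seq a025242 n | n <- iota 1 10]
    = [:: 1; 2; 5; 13; 35; 97; 275; 794; 2327; 6905].
Proof.
have avoiderE n Pe Pe' P t : (forall t, contains t Pe <-> ~~ avoids P t) ->
    (forall t, contains t Pe' <-> ~~ avoids P t) ->
    avoider n Pe t <-> avoider n Pe' t.
  by move=> PeP Pe'P; split=> -[tn av]; split=> //; [move/Pe'P/PeP | move/PeP/Pe'P].
split; last split; last split.
- move=> n n0; split.
  + exact: fmap_bij_between n0 (contains_2134 _ _) avoids_words_Z1.
  + exact: fmap_bij_between n0 (contains_3214 _ _) avoids_words_Z2.
  + exact: fmap_bij_between n0 (contains_1324 _ _) avoids_words_Z3.
  + exact: fmap_bij_between n0 (contains_1243 _ _) avoids_words_Z4.
- move=> n x y z t _ _; split.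
  + exact: avoiderE (contains_2134 _ _) (contains_2134 _ _).
  + exact: avoiderE (contains_3214 _ _) (contains_3214 _ _).
  + exact: avoiderE (contains_1324 _ _) (contains_1324 _ _).
  + exact: avoiderE (contains_1243 _ _) (contains_1243 _ _).
- case=> // n _; split.
  + by rewrite (cardM_count_trees _ avoids_words_Z1) count_2134.
  + by rewrite (cardM_count_trees _ avoids_words_Z2) count_3214.
  + by rewrite (cardM_count_trees _ avoids_words_Z3) count_1324.
  + by rewrite (cardM_count_trees _ avoids_words_Z4) count_1243.
- by vm_compute.
Qed.
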